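(* Let $A$ be a residuated lattice, and consider the conditions: $(\star )$ for all $x\in A$, there exist $u\in \mathrm{Rad}(A)$ and $e\in \mathcal{B}(A)$ such that $[x)=[u)\vee [e)$; $(\star \star )$ for all $x\in A$, there exist $u\in A$ and $e\in \mathcal{B}(A)$ such that $\neg u\in N(A)$ and $[x)=[u)\vee [e)$. Then: (1) if $A$ satisfies $(\star )$, then $A$ has the Boolean Lifting Property (BLP); (2) if $A$ has BLP, then $A$ satisfies $(\star \star )$; (3) if $\odot =\wedge$ in $A$, then the three properties are equivalent: $A$ satisfies $(\star )$ iff $A$ has BLP iff $A$ satisfies $(\star \star )$.
   Context: A residuated lattice is a commutative integral bounded one: a structure $(A,\vee ,\wedge ,\odot ,\rightarrow ,0,1)$ such that $(A,\vee ,\wedge ,0,1)$ is a bounded lattice, $(A,\odot ,1)$ is a commutative monoid, and $a\leq b\rightarrow c$ iff $a\odot b\leq c$ for all $a,b,c$. Write $\neg a=a\rightarrow 0$, $a\leftrightarrow b=(a\rightarrow b)\wedge (b\rightarrow a)$, and $a^n$ for the $n$-fold $\odot$-power. $\mathcal{B}(A)$ is the set of complemented elements of the bounded lattice reduct of $A$. $N(A)=\{x\in A : x^n=0 \text{ for some } n\geq 1\}$ is the set of nilpotent elements. A filter of $A$ is a nonempty subset closed under $\odot$ and upward closed; $[x)=\{y\in A : x^n\leq y \text{ for some } n\geq 1\}$ is the filter generated by $x$; for filters $F,G$, $F\vee G$ is the filter generated by $F\cup G$. A maximal filter is a maximal element, under inclusion, of the set of filters different from $A$. $\mathrm{Rad}(A)$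 is the intersection of all maximal filters of $A$ (equal to $A$ if $A$ is trivial, i.e. $0=1$). For a filter $F$, $A/F$ is the quotient residuated lattice by the congruence $a\equiv b$ iff $a\leftrightarrow b\in F$, with classes $a/F$. $F$ has BLP iff for every $f\in \mathcal{B}(A/F)$ there is $e\in \mathcal{B}(A)$ with $e/F=f$. $A$ has BLP iff all its filters have BLP. *)

(* Defs.v *)
From HB Require Import structures.
From mathcomp Require Import all_boot all_order.
From mathcomp Require Import boolp classical_sets.

Set Implicit Arguments.
Unset Strict Implicit.
Unset Printing Implicit Defensive.

Import Order.TTheory.
Local Open Scope order_scope.

Reserved Notation "x \odot y" (at level 40, left associativity).
Reserved Notation "x \imp y" (at level 55, right associativity).
Reserved Notation "x \biimp y" (at level 56, no associativity).

(* Commutative integral bounded residuated lattices; integrality is the fact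
   that the monoid unit is the lattice top.  The trivial algebra
   (\bot = \top) is allowed. *)
HB.mixin Record TBLattice_isResiduated (d : Order.disp_t) (A : Type)
    of Order.TBLattice d A := {
  rl_mul : A -> A -> A;
  rl_imp : A -> A -> A;
  rl_mulA : associative rl_mul;
  rl_mulC : commutative rl_mul;
  rl_mul1x : left_id \top rl_mul;
  rl_resid : forall a b c : A, (a <= rl_imp b c) = (rl_mul a b <= c)
}.

#[short(type="residLatticeType")]
HB.structure Definition ResidLattice (d : Order.disp_t) :=
  { A of TBLattice_isResiduated d A & Order.TBLattice d A }.

Notation "x \odot y" := (rl_mul x y) : order_scope.
Notation "x \imp y" := (rl_imp x y) : order_scope.

Definition complemented (d : Order.disp_t) (L : tbLatticeType d) : set L :=
  [set x : L | exists y : L, (x `|` y = \top /\ x `&` y = \bot)%O]%classic.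

Section Notions.
Context {d : Order.disp_t} {A : residLatticeType d}.
Implicit Types (x y : A) (F G : set A).

Definition rl_neg x : A := x \imp \bot.
Definition rl_biimp x y : A := (x \imp y) `&` (y \imp x).
Definition rl_pow x (n : nat) : A := iter n (rl_mul x) \top.

Definition nilpotents : set A :=
  [set x | exists n : nat, (1 <= n)%N /\ rl_pow x n = \bot%O]%classic.

Definition is_filter F : Prop :=
  [/\ (F !=set0)%classic,
      forall x y, F x -> F y -> F (x \odot y) &
      forall x y, F x -> x <= y -> F y].

Definition principal x : set A :=
  [set y | exists n : nat, (1 <= n)%N /\ (rl_pow x n <= y)%O]%classic.

Definition filter_join F G : set A :=
  smallest is_filter (F `|` G)%classic.

Definition maximal_filter F : Prop :=
  [/\ is_filter F, F <> setT &
      forall G, is_filter G -> G <> setT -> (F `<=` G)%classic -> G = F].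

Definition Rad : set A := (\bigcap_(M in maximal_filter) M)%classic.

End Notions.

Notation "x \biimp y" := (rl_biimp x y) : order_scope.
Arguments nilpotents {d} A.
Arguments Rad {d} A.

Record rl_filter (d : Order.disp_t) (A : residLatticeType d) := RLFilter {
  filter_set :> A -> Prop;
  filter_setP : is_filter filter_set
}.

Section ResidTheory.
Context {d : Order.disp_t} {A : residLatticeType d}.
Implicit Types x y z t : A.

Lemma rl_mulx1 : right_id \top (@rl_mul d A).
Proof. by move=> x; rewrite rl_mulC rl_mul1x. Qed.

Lemma rl_imp_mul x y : (x \imp y) \odot x <= y.
Proof. by rewrite -rl_resid. Qed.

Lemma rl_mul_monol x y z : x <= y -> x \odot z <= y \odot z.
Proof. by move=> xy; rewrite -rl_resid (le_trans xy)// rl_resid. Qed.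

Lemma rl_mul_monor x y z : x <= y -> z \odot x <= z \odot y.
Proof. by move=> xy; rewrite ![z \odot _]rl_mulC rl_mul_monol. Qed.

Lemma rl_mul_mono x y z t : x <= y -> z <= t -> x \odot z <= y \odot t.
Proof.
by move=> xy zt; apply: le_trans (rl_mul_monol _ xy) (rl_mul_monor _ zt).
Qed.

Lemma rl_mul_lel x y : x \odot y <= x.
Proof. by rewrite -[leRHS]rl_mulx1 rl_mul_monor// lex1. Qed.

Lemma rl_mul_ler x y : x \odot y <= y.
Proof. by rewrite rl_mulC rl_mul_lel. Qed.

Lemma rl_imp_top x y : x <= y -> x \imp y = \top.
Proof. by move=> xy; apply/eqP; rewrite eq_le lex1 rl_resid rl_mul1x. Qed.

End ResidTheory.

(* The preorder x \imp y \in F, whose associated equivalence is the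
   congruence of F. *)
Section FilterPreorder.
Context {d : Order.disp_t} {A : residLatticeType d} (F : rl_filter A).
Implicit Types x y z t : A.

Definition fle x y := F (x \imp y).

Lemma filter_up x y : F x -> x <= y -> F y.
Proof. by case: (filter_setP F) => _ _; apply. Qed.

Lemma filter_mul x y : F x -> F y -> F (x \odot y).
Proof. by case: (filter_setP F) => _ + _; apply. Qed.

Lemma filter_top : F \top.
Proof. by case: (filter_setP F) => -[x Fx] _ up; apply: up Fx (lex1 x). Qed.

Lemma filter_meet x y : F (x `&` y) <-> F x /\ F y.
Proof.
split=> [Fxy|[Fx Fy]].
  by split; apply: filter_up Fxy _; [apply: leIl|apply: leIr].
by apply: filter_up (filter_mul Fx Fy) _; rewrite lexI rl_mul_lel rl_mul_ler.
Qed.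

Lemma le_fle x y : x <= y -> fle x y.
Proof. by move=> xy; rewrite /fle rl_imp_top//; apply: filter_top. Qed.

Lemma fle_trans y x z : fle x y -> fle y z -> fle x z.
Proof.
move=> xy yz; apply: filter_up (filter_mul yz xy) _.
rewrite rl_resid -rl_mulA (le_trans _ (rl_imp_mul y z))//.
by rewrite rl_mul_monor// rl_imp_mul.
Qed.

Lemma fle_meet x y z : fle x (y `&` z) <-> fle x y /\ fle x z.
Proof.
split=> [H|[xy xz]].
  by split; apply: fle_trans H _; apply: le_fle; [apply: leIl|apply: leIr].
move/filter_meet: (conj xy xz) => H; apply: filter_up H _.
rewrite rl_resid lexI -!rl_resid; apply/andP; split;
  [exact: leIl|exact: leIr].
Qed.

Lemma fle_join x y z : fle (x `|` y) z <-> fle x z /\ fle y z.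
Proof.
split=> [H|[xz yz]].
  split; apply: fle_trans H; apply: le_fle; [exact: leUl|exact: leUr].
move/filter_meet: (conj xz yz) => H; apply: filter_up H _.
rewrite rl_resid rl_mulC -rl_resid leUx !rl_resid.
rewrite ![_ \odot ((_ \imp _) `&` _)]rl_mulC -!rl_resid.
by apply/andP; split; [exact: leIl|exact: leIr].
Qed.

Lemma fle_resid x y z : fle x (y \imp z) <-> fle (x \odot y) z.
Proof.
split=> H; apply: filter_up H _.
  rewrite rl_resid rl_mulA -rl_resid; exact: rl_imp_mul.
by rewrite rl_resid rl_resid -rl_mulA; apply: rl_imp_mul.
Qed.

Lemma fle_mull x y z : fle x y -> fle (x \odot z) (y \odot z).
Proof.
move=> xy; apply: filter_up xy _.
by rewrite rl_resid rl_mulA rl_mul_monol// rl_imp_mul.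
Qed.

Lemma fle_mul x y z t : fle x y -> fle z t -> fle (x \odot z) (y \odot t).
Proof.
move=> xy zt; apply: (@fle_trans (y \odot z)); first exact: fle_mull.
by rewrite ![y \odot _]rl_mulC; apply: fle_mull.
Qed.

Lemma fle_imp x y z t : fle y x -> fle z t -> fle (x \imp z) (y \imp t).
Proof.
move=> yx zt; apply/fle_resid; apply: fle_trans zt.
apply: (@fle_trans ((x \imp z) \odot x)); last exact/le_fle/rl_imp_mul.
by rewrite ![(x \imp z) \odot _]rl_mulC; apply: fle_mull.
Qed.

Definition filter_rel x y : bool := `[< F (x \biimp y) >].

Lemma filter_relP x y : reflect (fle x y /\ fle y x) (filter_rel x y).
Proof. by apply: (iffP (asboolP _)) => /filter_meet. Qed.

Lemma filter_rel_refl : reflexive filter_rel.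
Proof. by move=> x; apply/filter_relP; split; apply: le_fle. Qed.

Lemma filter_rel_sym : symmetric filter_rel.
Proof. by move=> x y; apply/filter_relP/filter_relP => -[]. Qed.

Lemma filter_rel_trans : transitive filter_rel.
Proof.
move=> y x z /filter_relP[xy yx] /filter_relP[yz zy].
by apply/filter_relP; split; [apply: fle_trans yz|apply: fle_trans yx].
Qed.

Canonical filter_equiv :=
  EquivRel filter_rel filter_rel_refl filter_rel_sym filter_rel_trans.

End FilterPreorder.

(* The quotient A/F.  The projection a |-> a/F is \pi_(rl_quot F). *)
Definition rl_quot (d : Order.disp_t) (A : residLatticeType d)
  (F : rl_filter A) : Type := {eq_quot (filter_equiv F)}%qT.

Section Quotient.
Context {d : Order.disp_t} {A : residLatticeType d} (F : rl_filter A).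
Local Open Scope quotient_scope.
Local Notation Q := (rl_quot F).

HB.instance Definition _ := Choice.on Q.
HB.instance Definition _ := EqQuotient.on Q.

Implicit Types a b c : A.
Implicit Types p q r : Q.

Definition class_of a : Q := \pi_Q a.

Lemma class_ofP a b : class_of a = class_of b <-> fle F a b /\ fle F b a.
Proof.
split; first by move/(@eqmodP _ (filter_equiv F)) => /filter_relP.
by move=> H; apply/(@eqmodP _ (filter_equiv F))/filter_relP.
Qed.

Lemma class_of_repr p : class_of (repr p) = p. Proof. exact: reprK. Qed.

Lemma classW (P : Q -> Prop) : (forall a, P (class_of a)) -> forall p, P p.
Proof. by move=> H p; rewrite -(class_of_repr p). Qed.

Lemma repr_class a : fle F (repr (class_of a)) a /\ fle F a (repr (class_of a)).
Proof. by apply/class_ofP; rewrite class_of_repr. Qed.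

Definition quot_le p q : bool := `[< fle F (repr p) (repr q) >].
Definition quot_meet p q : Q := class_of (repr p `&` repr q).
Definition quot_join p q : Q := class_of (repr p `|` repr q).
Definition quot_mul p q : Q := class_of (repr p \odot repr q).
Definition quot_imp p q : Q := class_of (repr p \imp repr q).

Lemma quot_leP a b : reflect (fle F a b) (quot_le (class_of a) (class_of b)).
Proof.
have [ra ar] := repr_class a; have [rb br] := repr_class b.
apply: (iffP (asboolP _)) => H.
  exact: fle_trans ar (fle_trans H rb).
exact: fle_trans ra (fle_trans H br).
Qed.

Lemma quot_le_refl : reflexive quot_le.
Proof. by elim/classW=> a; apply/quot_leP/le_fle. Qed.

Lemma quot_le_anti : antisymmetric quot_le.
Proof.
elim/classW=> a; elim/classW=> b /andP[/quot_leP ab /quot_leP ba].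
exact/class_ofP.
Qed.

Lemma quot_le_trans : transitive quot_le.
Proof.
elim/classW=> b; elim/classW=> a; elim/classW=> c /quot_leP ab /quot_leP bc.
exact/quot_leP/(fle_trans ab).
Qed.

HB.instance Definition _ :=
  Order.Le_isPOrder.Build d Q quot_le_refl quot_le_anti quot_le_trans.

Lemma quot_leE a b : reflect (fle F a b) (class_of a <= class_of b).
Proof. exact: quot_leP. Qed.

Lemma quot_meetE a b :
  quot_meet (class_of a) (class_of b) = class_of (a `&` b).
Proof.
have [ra ar] := repr_class a; have [rb br] := repr_class b.
apply/class_ofP; split; apply/fle_meet; split.
- by apply: fle_trans ra; apply/le_fle/leIl.
- by apply: fle_trans rb; apply/le_fle/leIr.
- by apply: fle_trans ar; apply/le_fle/leIl.
- by apply: fle_trans br; apply/le_fle/leIr.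
Qed.

Lemma quot_joinE a b :
  quot_join (class_of a) (class_of b) = class_of (a `|` b).
Proof.
have [ra ar] := repr_class a; have [rb br] := repr_class b.
apply/class_ofP; split; apply/fle_join; split.
- by apply: fle_trans ra _; apply/le_fle/leUl.
- by apply: fle_trans rb _; apply/le_fle/leUr.
- by apply: fle_trans ar _; apply/le_fle/leUl.
- by apply: fle_trans br _; apply/le_fle/leUr.
Qed.

Lemma quot_mulE a b :
  quot_mul (class_of a) (class_of b) = class_of (a \odot b).
Proof.
have [ra ar] := repr_class a; have [rb br] := repr_class b.
by apply/class_ofP; split; apply: fle_mul.
Qed.

Lemma quot_impE a b :
  quot_imp (class_of a) (class_of b) = class_of (a \imp b).
Proof.
have [ra ar] := repr_class a; have [rb br] := repr_class b.
by apply/class_ofP; split; apply: fle_imp.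
Qed.

Lemma quot_meetP p q r : (p <= quot_meet q r) = (p <= q) && (p <= r).
Proof.
elim/classW: p => a; elim/classW: q => b; elim/classW: r => c.
rewrite quot_meetE; apply/quot_leE/andP => [/fle_meet|] [ab ac].
  by split; apply/quot_leE.
by apply/fle_meet; split; apply/quot_leE.
Qed.

Lemma quot_joinP p q r : (quot_join p q <= r) = (p <= r) && (q <= r).
Proof.
elim/classW: p => a; elim/classW: q => b; elim/classW: r => c.
rewrite quot_joinE; apply/quot_leE/andP => [/fle_join|] [ac bc].
  by split; apply/quot_leE.
by apply/fle_join; split; apply/quot_leE.
Qed.

HB.instance Definition _ :=
  Order.POrder_MeetJoin_isLattice.Build d Q quot_meetP quot_joinP.

Lemma quot_le0 p : class_of \bot <= p.
Proof. by elim/classW: p => a; apply/quot_leE/le_fle/le0x. Qed.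

Lemma quot_le1 p : p <= class_of \top.
Proof. by elim/classW: p => a; apply/quot_leE/le_fle/lex1. Qed.

HB.instance Definition _ := Order.hasBottom.Build d Q quot_le0.
HB.instance Definition _ := Order.hasTop.Build d Q quot_le1.

Lemma quot_mulA : associative quot_mul.
Proof.
elim/classW=> a; elim/classW=> b; elim/classW=> c.
by rewrite !quot_mulE rl_mulA.
Qed.

Lemma quot_mulC : commutative quot_mul.
Proof. by elim/classW=> a; elim/classW=> b; rewrite !quot_mulE rl_mulC. Qed.

Lemma quot_mul1x : left_id (\top : Q) quot_mul.
Proof. by elim/classW=> a; rewrite quot_mulE rl_mul1x. Qed.

Lemma quot_resid p q r : (p <= quot_imp q r) = (quot_mul p q <= r).
Proof.
elim/classW: p => a; elim/classW: q => b; elim/classW: r => c.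
rewrite quot_impE quot_mulE.
by apply/quot_leE/quot_leE => /fle_resid.
Qed.

HB.instance Definition _ := TBLattice_isResiduated.Build d Q
  quot_mulA quot_mulC quot_mul1x quot_resid.

End Quotient.

Arguments class_of {d A} F a.

Section BLP.
Context {d : Order.disp_t} (A : residLatticeType d).

Definition filter_BLP (F : rl_filter A) : Prop :=
  forall f : rl_quot F, complemented f ->
    exists e : A, complemented e /\ class_of F e = f.

Definition BLP : Prop := forall F : rl_filter A, filter_BLP F.

Definition star_condition : Prop :=
  forall x : A, exists u e : A,
    [/\ Rad A u, complemented e &
        principal x = filter_join (principal u) (principal e)].

Definition star_star_condition : Prop :=
  forall x : A, exists u e : A,
    [/\ nilpotents A (rl_neg u), complemented e &
        principal x = filter_join (principal u) (principal e)].

End BLP.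

(* Main.v *)
Require Import Defs.
From mathcomp Require Import all_boot all_order.
From mathcomp Require Import boolp classical_sets.

(** Three facts carry the proof.

    An element [e] is complemented iff [e `|` rl_neg e = \top]
    ([complementedP]), and then it is idempotent.  Hence, for [e] complemented,
    [[x) = [u) \/ [e)] says exactly that [e] and [u] lie in [[x)] and that
    [u^n \odot e <= x] for some [n >= 1] ([principal_joinP]).  Finally, by
    Zorn's lemma, [u] is in the radical iff every [rl_neg (u^n)] is nilpotent
    ([RadP]).

    (1) Let [a/F] be complemented and write [[a) = [u) \/ [e)] with [u] in the
    radical.  From [a^k <= e] and the idempotence of [a/F] one gets
    [a/F <= e/F].  From [u^n \odot e <= a] one gets that
    [e \odot rl_neg a <= rl_neg (u^n)] is nilpotent; its class is idempotent,
    hence zero, and so [e/F <= a/F].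

    (2) Given [x], put [u = x `|` rl_neg x].  Then [rl_neg u] has square zero,
    and [x] becomes complemented modulo [[u)].  A complemented lift [e] of
    [x/[u)] satisfies [u^n \odot e <= x] and [u^m \odot x <= e]; since
    [x <= u], this gives [[x) = [u) \/ [e)].

    (3) If the product is the meet, every [u] is idempotent, so all the
    [rl_neg (u^n)] lie below [rl_neg u], and [u] is in the radical as soon as
    [rl_neg u] is nilpotent. *)

Local Open Scope order_scope.
Import Order.TTheory.

(** * Residuated lattices: complements, filters and the radical *)

Section ResidLatticeTheory.
Context {d : Order.disp_t} {A : residLatticeType d}.
Implicit Types (x y z e u : A) (n m : nat).

Lemma rl_mul_joinr x y z : x \odot (y `|` z) = (x \odot y) `|` (x \odot z).
Proof.
apply/eqP; rewrite eq_le leUx !rl_mul_monor ?leUl ?leUr// andbT.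
by rewrite rl_mulC -rl_resid leUx !rl_resid ![_ \odot x]rl_mulC leUl leUr.
Qed.

Lemma rl_mul_neg x : x \odot rl_neg x = \bot.
Proof. by apply/eqP; rewrite -lex0 rl_mulC rl_imp_mul. Qed.

Lemma le_rl_neg x y : (x <= rl_neg y) = (x \odot y == \bot).
Proof. by rewrite /rl_neg rl_resid lex0. Qed.

Lemma rl_neg_le x y : x <= y -> rl_neg y <= rl_neg x.
Proof.
by move=> xy; rewrite le_rl_neg -lex0 -(rl_mul_neg y) rl_mulC rl_mul_monol.
Qed.

Lemma rl_mulACA x y z u :
  (x \odot y) \odot (z \odot u) = (x \odot z) \odot (y \odot u).
Proof. by rewrite -!rl_mulA (rl_mulA y) (rl_mulC y) !rl_mulA. Qed.

Lemma rl_powD x n m : rl_pow x (n + m) = rl_pow x n \odot rl_pow x m.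
Proof. by elim: n => [|n IHn] /=; rewrite ?rl_mul1x// IHn rl_mulA. Qed.

Lemma rl_powMl x y n : rl_pow (x \odot y) n = rl_pow x n \odot rl_pow y n.
Proof. by elim: n => [|n IHn] /=; rewrite ?rl_mul1x// IHn rl_mulACA. Qed.

Lemma rl_pow_le x y n : x <= y -> rl_pow x n <= rl_pow y n.
Proof. by move=> xy; elim: n => //= n IHn; apply: rl_mul_mono. Qed.

Lemma rl_pow_idem x n : x \odot x = x -> (1 <= n)%N -> rl_pow x n = x.
Proof.
move=> xx; elim: n => // -[|n] IHn _; first exact: rl_mulx1.
by rewrite -addn1 rl_powD IHn//= rl_mulx1.
Qed.

(** If [e] has a complement at all, that complement is [rl_neg e]. *)
Lemma complementedP e : complemented e <-> e `|` rl_neg e = \top.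
Proof.
split=> [[y [eUy eIy]]|eUn].
  apply/eqP; rewrite -le1x -eUy leU2// le_rl_neg -lex0 -eIy.
  by rewrite lexI rl_mul_lel rl_mul_ler.
exists (rl_neg e); split=> //; apply/eqP.
rewrite -lex0 -[leLHS]rl_mulx1 -eUn rl_mul_joinr leUx; apply/andP; split.
  by rewrite -(rl_mul_neg e) rl_mulC rl_mul_monor// leIr.
by rewrite -(rl_mul_neg e) rl_mul_monol// leIl.
Qed.

Lemma complemented_neg e : complemented e -> complemented (rl_neg e).
Proof.
move=> /complementedP eUn; apply/complementedP/eqP.
rewrite -le1x -eUn joinC leU2// le_rl_neg.
by rewrite rl_mul_neg.
Qed.

Lemma complemented_idem e : complemented e -> e \odot e = e.
Proof.
by move=> /complementedP eUn; rewrite -[RHS]rl_mulx1 -eUn rl_mul_joinr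
  rl_mul_neg joinx0.
Qed.

Lemma complemented_le e x : complemented e -> x \odot rl_neg e = \bot -> x <= e.
Proof.
move=> /complementedP eUn xn0.
by rewrite -[x]rl_mulx1 -eUn rl_mul_joinr xn0 joinx0 rl_mul_ler.
Qed.

Lemma nilpotents_le x y : x <= y -> nilpotents A y -> nilpotents A x.
Proof.
move=> xy [n [n1 yn0]]; exists n; split=> //.
by apply/eqP; rewrite -lex0 -yn0 rl_pow_le.
Qed.

Lemma is_filter_top (F : set A) : is_filter F -> F \top.
Proof. by move=> [[x Fx] _ up]; apply: up Fx (lex1 x). Qed.

Lemma is_filter_pow (F : set A) x n : is_filter F -> F x -> F (rl_pow x n).
Proof.
move=> FF Fx; elim: n => [|n IHn]; first exact: is_filter_top.
by case: FF => _ + _; apply.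
Qed.

Lemma is_filter_properP (F : set A) : is_filter F -> F <> setT <-> ~ F \bot.
Proof.
move=> [_ _ up]; split=> [FT F0|F0 FT]; last by apply: F0; rewrite FT.
by apply: FT; apply/seteqP; split=> // x _; apply: up F0 (le0x x).
Qed.

Lemma principal_id x : principal x x.
Proof. by exists 1; rewrite /= rl_mulx1. Qed.

Lemma principal_filter x : is_filter (principal x).
Proof.
split; first by exists x; apply: principal_id.
  move=> y z [n [n1 xy]] [m [_ xz]]; exists (n + m)%N.
  by rewrite ltn_addr// rl_powD rl_mul_mono.
by move=> y z [n [n1 xy]] yz; exists n; rewrite (le_trans xy).
Qed.

Lemma principal_sub (F : set A) x :
  is_filter F -> (principal x `<=` F)%classic <-> F x.
Proof.
move=> FF; split=> [|Fx y [n [_ xy]]]; first by apply; apply: principal_id.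
by case: (FF) => _ _ up; apply: up xy; apply: is_filter_pow.
Qed.

Lemma filter_join_principal x y :
  filter_join (principal x) (principal y) = principal (x \odot y).
Proof.
apply/seteqP; split.
  apply: smallest_sub; first exact: principal_filter.
  have [_ _ up] := principal_filter (x \odot y).
  rewrite subUset; split; apply/principal_sub; try exact: principal_filter.
    by apply: up (principal_id _) _; apply: rl_mul_lel.
  by apply: up (principal_id _) _; apply: rl_mul_ler.
move=> z xyz F [FF FU]; move: z xyz; apply/principal_sub => //.
case: FF => _ Fmul _.
by apply: Fmul; apply: FU; [left|right]; apply: principal_id.
Qed.

Lemma principal_joinP x u e : complemented e ->
  principal x = filter_join (principal u) (principal e) <->
  [/\ principal x u, principal x e &
      exists n, (1 <= n)%N /\ rl_pow u n \odot e <= x].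
Proof.
move=> /complemented_idem ee; rewrite filter_join_principal.
have [_ xmul xup] := principal_filter x.
split=> [xue|[xu xe [n [n1 uex]]]]; last first.
  apply/seteqP; split; apply/principal_sub; try exact: principal_filter.
    by exists n; rewrite rl_powMl (rl_pow_idem _ _ ee).
  exact: xmul.
have xue' : principal x (u \odot e) by rewrite xue; apply: principal_id.
split; [exact: xup xue' (rl_mul_lel _ _)|exact: xup xue' (rl_mul_ler _ _)|].
have [n [n1]] : principal (u \odot e) x by rewrite -xue; apply: principal_id.
by rewrite rl_powMl (rl_pow_idem _ _ ee)// => uex; exists n.
Qed.

(** The ultrafilter lemma for residuated lattices. *)
Lemma maximal_filter_ex (F : set A) : is_filter F -> ~ F \bot ->
  exists M, maximal_filter M /\ (F `<=` M)%classic.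
Proof.
move=> FF F0.
(* Adjoining F to each member handles the empty chain, whose union is not a
   filter. *)
pose P (X : set A) := is_filter (F `|` X)%classic /\ ~ (F `|` X)%classic \bot.
have [C CP Ctot|X [[FX X0] Xmax]] := @Zorn_bigcup A P.
  split; last by case=> // -[X /CP[_ X0] X0']; apply: X0; right.
  split; first by exists \top; left; apply: is_filter_top.
    have [_ Fmul _] := FF.
    have mulFX x y X : C X -> F x \/ X x -> F y \/ X y ->
        (F `|` \bigcup_(X in C) X)%classic (x \odot y).
      move=> CX Xx Xy; have [[_ + _] _] := CP _ CX.
      by move=> /(_ x y Xx Xy)[]; [left|right; exists X].
    move=> x y [Fx [Fy|[Y CY Yy]]|[X CX Xx] [Fy|[Y CY Yy]]].
    - by left; apply: Fmul.
    - by apply: (mulFX _ _ Y) => //; [left|right].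
    - by apply: (mulFX _ _ X) => //; [right|left].
    - have [XY|YX] := Ctot _ _ CX CY.
        by apply: (mulFX _ _ Y) => //; right=> //; apply: XY.
      by apply: (mulFX _ _ X) => //; right=> //; apply: YX.
  move=> x y [Fx|[X CX Xx]] xy.
    by left; case: FF => _ _; apply; [exact: Fx|].
  have [[_ _ up] _] := CP _ CX.
  have [|Fy|Xy] := up x y _ xy; [by right|by left|by right; exists X].
exists (F `|` X)%classic; split; last by move=> x; left.
split=> //; first exact/is_filter_properP.
move=> G GF /(is_filter_properP _ GF) G0 XG.
have FG : (F `|` G)%classic = G.
  by apply/seteqP; split=> [x [Fx|]|x]//; [apply: XG; left|right].
have XsubG : (X `<=` G)%classic by move=> x Xx; apply: XG; right.
apply/seteqP; split=> //.
apply: contrapT => nGX; apply: (Xmax G); last by rewrite /P FG.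
rewrite properEneq; split=> //; apply/eqP => XG'.
by apply: nGX => x; rewrite -XG'; right.
Qed.

(** Left to right, a non-nilpotent [rl_neg (u^n)] would lie in some maximal
    filter together with [u^n].  Right to left, a maximal filter missing [u]
    contains some [z] with [z \odot u^n = \bot], hence contains the nilpotent
    [rl_neg (u^n)]. *)
Lemma RadP u : Rad A u <-> forall n, nilpotents A (rl_neg (rl_pow u n)).
Proof.
split=> [Ru n|nil M Mmax].
  apply: contrapT => nnil.
  have [||M [Mmax nM]] := @maximal_filter_ex (principal (rl_neg (rl_pow u n))).
  - exact: principal_filter.
  - move=> [k [k1 uk]]; apply: nnil; exists k; split=> //.
    by apply/eqP; rewrite -lex0.
  have [MF /(is_filter_properP _ MF) M0 _] := Mmax.
  have Mu : M (rl_pow u n) by apply: is_filter_pow => //; apply: Ru.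
  have Mn := nM _ (principal_id _).
  by apply: M0; rewrite -(rl_mul_neg (rl_pow u n)); case: MF => _ + _; apply.
have [MF /(is_filter_properP _ MF) M0 Mm] := Mmax.
have [_ Mmul Mup] := MF.
apply: contrapT => nMu.
(* The filter generated by M and u. *)
pose G : set A := [set y | exists z n, M z /\ z \odot rl_pow u n <= y]%classic.
have GF : is_filter G.
  split; first by exists \top, \top, 0; rewrite lex1; split=> //; apply: is_filter_top.
    move=> y z [m [n [Mm1 my]]] [m' [n' [Mm' mz]]].
    exists (m \odot m'), (n + n')%N; split; first exact: Mmul.
    by rewrite rl_powD rl_mulACA rl_mul_mono.
  by move=> y z [m [n [Mm1 my]]] yz; exists m, n; rewrite (le_trans my).
have MG : (M `<=` G)%classic.
  by move=> m Mm1; exists m, 0; rewrite rl_mulx1.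
have Gu : G u.
  by exists \top, 1; rewrite /= rl_mulx1 rl_mul1x; split=> //; apply: is_filter_top.
(* By maximality G is improper, so some m in M annihilates a power of u. *)
have [m [n [Mm1 mu0]]] : G \bot.
  apply: contrapT => /(is_filter_properP _ GF) GT.
  by apply: nMu; rewrite -(Mm G GF GT MG).
have [k [_ k0]] := nil n.
apply: M0; rewrite -k0; apply: is_filter_pow => //.
by apply: Mup Mm1 _; rewrite le_rl_neg -lex0.
Qed.

Lemma Rad_idem u : u \odot u = u -> nilpotents A (rl_neg u) -> Rad A u.
Proof.
move=> uu nil; apply/RadP => n; apply: nilpotents_le nil.
by apply: rl_neg_le; case: n => [|n]; rewrite ?lex1// rl_pow_idem.
Qed.

End ResidLatticeTheory.

(** * The projection onto a quotient is a homomorphism *)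

Section QuotientMorphism.
Context {d : Order.disp_t} {A : residLatticeType d} (F : rl_filter A).
Implicit Types x y e : A.

Lemma class_of_mul x y :
  class_of F (x \odot y) = class_of F x \odot class_of F y.
Proof. by rewrite -quot_mulE. Qed.

Lemma class_of_join x y :
  class_of F (x `|` y) = class_of F x `|` class_of F y.
Proof. by rewrite -quot_joinE. Qed.

Lemma class_of_neg x : class_of F (rl_neg x) = rl_neg (class_of F x).
Proof. by rewrite /rl_neg -quot_impE. Qed.

Lemma class_of_pow x n : class_of F (rl_pow x n) = rl_pow (class_of F x) n.
Proof. by elim: n => //= n <-; rewrite class_of_mul. Qed.

Lemma class_of_le x y : x <= y -> class_of F x <= class_of F y.
Proof. by move=> xy; apply/quot_leE/le_fle. Qed.

Lemma class_of_top x : F x -> class_of F x = \top.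
Proof.
move=> Fx; apply/eqP; rewrite -le1x; apply/quot_leE.
by apply: filter_up Fx _; rewrite rl_resid rl_mul_lel.
Qed.

End QuotientMorphism.

(** * Boolean lifting *)

Section BooleanLifting.
Context {d : Order.disp_t} (A : residLatticeType d).

Lemma star_BLP : star_condition A -> BLP A.
Proof.
move=> star F; apply: classW => a cfa.
have [u [e [/RadP Ru ce]]] := star a.
move=> /(principal_joinP _ _ _ ce)[_ [k [k1 ake]] [n [n1 uea]]].
exists e; split=> //; apply/eqP; rewrite eq_le; apply/andP; split; last first.
  by rewrite -(rl_pow_idem _ _ (complemented_idem _ cfa) k1) -class_of_pow
    class_of_le.
apply: complemented_le => //.
rewrite -class_of_neg -class_of_mul.
(* The element e \odot rl_neg a is nilpotent and idempotent modulo F. *)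
have [m [m1 em0]] : nilpotents A (e \odot rl_neg a).
  apply: nilpotents_le (Ru n).
  rewrite le_rl_neg rl_mulC rl_mulA -lex0 -(rl_mul_neg a).
  exact: rl_mul_monol.
have idem : class_of F (e \odot rl_neg a) \odot class_of F (e \odot rl_neg a)
    = class_of F (e \odot rl_neg a).
  rewrite -class_of_mul rl_mulACA (complemented_idem _ ce) !class_of_mul.
  by rewrite class_of_neg (complemented_idem _ (complemented_neg _ cfa)).
by rewrite -(rl_pow_idem _ _ idem m1) -class_of_pow em0.
Qed.

Lemma BLP_star_star : BLP A -> star_star_condition A.
Proof.
move=> blp x; pose u := x `|` rl_neg x.
pose F := RLFilter (principal_filter u).
have cx : complemented (class_of F x).
  apply/complementedP; rewrite -class_of_neg -class_of_join.
  exact/class_of_top/principal_id.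
have [e [ce /class_ofP[[n [n1 nex]] [m [m1 mxe]]]]] := blp F _ cx.
exists u, e; split=> //.
  exists 2; split=> //=; rewrite rl_mulx1; apply/eqP.
  rewrite -lex0 -(rl_mul_neg (rl_neg x)).
  by rewrite rl_mul_mono// rl_neg_le// ?leUl// leUr.
apply/(principal_joinP _ _ _ ce); split.
- by exists 1; rewrite /= rl_mulx1 leUl.
- exists m.+1; split=> //=; rewrite rl_mulC.
  rewrite rl_resid in mxe; apply: le_trans mxe.
  by rewrite rl_mul_monol// rl_pow_le// leUl.
- by exists n; rewrite -rl_resid.
Qed.

Lemma star_star_star : (forall a b : A, a \odot b = a `&` b) ->
  star_star_condition A -> star_condition A.
Proof.
move=> mulI ss x; have [u [e [nil ce xue]]] := ss x.
by exists u, e; split=> //; apply: Rad_idem nil; rewrite mulI meetxx.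
Qed.

End BooleanLifting.

Theorem proposition6p3 (d : Order.disp_t) (A : residLatticeType d) :
  [/\ star_condition A -> BLP A,
      BLP A -> star_star_condition A &
      (forall a b : A, a \odot b = a `&` b) ->
        (star_condition A <-> BLP A) /\ (BLP A <-> star_star_condition A)].
Proof.
split; [exact: star_BLP|exact: BLP_star_star|move=> mulI].
have ss := @star_star_star _ _ mulI.
split; split.
- exact: star_BLP.
- by move=> /BLP_star_star/ss.
- exact: BLP_star_star.
- by move=> /ss/star_BLP.
Qed.
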